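(* Let $(\mathcal T,\Sigma)$ be a full, generic, trimmed signed tropical $(n,d)$-matroid. Then the following procedure (procedure FindWitness, described in the context), applied to $(\mathcal T,\Sigma)$, terminates and returns either a totally infeasible basic covector in $\mathcal T$ (with answer ''infeasible'') or a feasible covector in a contraction of $\mathcal T$ (with answer ''feasible''), and it makes at most $d-1$ calls to the subroutine FindExtremeCovector.
   Context: Notation: $[m]=\{1,\dots,m\}$. Subgraphs $G$ of the complete bipartite graph $K_{d,n}$ on $[d]\sqcup[n]$ are identified with their edge sets $\subseteq[d]\times[n]$; nodes in $[d]$ are coordinate nodes, nodes in $[n]$ are apex nodes. Put $\operatorname{conv}(G)=\operatorname{conv}\{(e_j,e_i)\mid (i,j)\in G\}\subset\mathbb R^n\times\mathbb R^d$. A signed tropical $(n,d)$-matroid (STM) is a pair $(\mathcal S,\Sigma)$ where $\mathcal S$ is a set of subgraphs of $K_{d,n}$ and $\Sigma=(\sigma_{ji})\in\{+,-,\bullet\}^{n\times d}$ such that, with the finity graph $\mathcal F=\bigcup_{G\in\mathcal S}G$, one has $\sigma_{ji}=\bullet\Leftrightarrow(i,j)\notin\mathcal F$, and: (1) no graph in $\mathcal S$ has an isolated node in $[n]$; (2) if $H\in\mathcal S$ then all subgraphs $G$ of $H$ without isolated node in $[n]$ for which $\operatorname{conv}(G)$ is a face of $\operatorname{conv}(H)$ are in $\mathcal S$; (3) each point of $\operatorname{conv}(\mathcal F)$ lies in $\operatorname{conv}(H)$ for some $H\in\mathcal S$; (4) for $G\ne H$ in $\mathcal S$, $\operatorname{conv}(G)\cap\operatorname{conv}(H)$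 is empty or a face of both. Graphs in $\mathcal S$ are called covectors (covector graphs). An edge $(i,j)$ is positive or negative according to $\sigma_{ji}=+$ or $-$. The STM is full if $\mathcal F=K_{d,n}$; generic if all its graphs are forests (equivalently the corresponding subdivision is a triangulation); trimmed if each row of $\Sigma$ contains at most one $-$. Contraction: for nonempty $I\subseteq[d]$, $\mathcal T|_I$ is the set of graphs of $\mathcal T$ in which all nodes of $[d]\setminus I$ are isolated, with these nodes deleted (or kept as isolated nodes); $\mathcal T|_{[d]}=\mathcal T$. A covector is infeasible if some apex node is only incident with negative edges, and feasible otherwise. It is totally infeasible if it is infeasible and every coordinate node is incident with a negative edge. Cramer covector: for $\delta\in[d]$, $D\subseteq[d]\setminus\{\delta\}$, $N\subseteq[n]$ with $|N|=|D|$, $\mathcal C(N,D\cup\{\delta\})$ is the unique covector in $\mathcal T|_{D\cup\{\delta\}}$ in which each node of $N$ has degree $2$ (it exists; all other apex nodes have degree $1$). A basic covector $y=\mathcal B(N,D,\delta)$ with distinguished direction $\delta$, support $D\cup\{\delta\}$ ($D\subseteq[d]\setminus\{\delta\}$) and basis $N\subseteq[n]$, $|N|=|D|$, is a covector graph on $[d]\sqcup[n]$ such that: it is a spanning tree on $(D\cup\{\delta\})\sqcup[n]$; nodes of $[d]\setminus(D\cup\{\delta\})$ are isolated; each node in $N$ has degree $2$; $\delta$ is not adjacent to a node of $N$ via a negative edge; each node of $N$ is incident with a positive and a negative edge; no two negative edges, each incident with some node in $N$, are adjacent. (It then equals $\mathcal C(N,D\cup\{\delta\})$.) Elements of $N$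 are basic apices, other apex nodes non-basic. An apex $j$ has shape $i$ if $\sigma_{ji}=-$. CheckFeasible$(y,\delta)$ for a basic covector $y=\mathcal B(N,D,\delta)$: if there is a non-basic apex only incident with a negative edge, return TOTALLY-INFEASIBLE if some negative edge is incident with $\delta$, and INFEASIBLE otherwise; if there is no such apex, return FEASIBLE. FindExtremeCovector$(y)$ for $y=\mathcal B(N,D,\delta)$: while CheckFeasible$(y,\delta)$ = INFEASIBLE: let $r$ be any non-basic apex incident to $D$ via a negative edge in $y$, let $p\in N$ be the basic apex of the same shape as $r$, replace $N$ by $(N\setminus\{p\})\cup\{r\}$ and $y$ by $\mathcal C(N,D\cup\{\delta\})$ (new $N$). Return $y$ (together with its basis $N$). Procedure FindWitness: choose $\delta\in[d]$, set $D=N=\emptyset$, $y=\mathcal C(\emptyset,\{\delta\})$. Repeat: (a) if CheckFeasible$(y,\delta)$ = INFEASIBLE, replace $y$ (and $N$) by the result of FindExtremeCovector$(y)$; (b) if CheckFeasible$(y,\delta)$ = FEASIBLE, return (''feasible'', $y$); (c) otherwise, if $D\cup\{\delta\}=[d]$, return (''infeasible'', $y$); (d) otherwise let $j$ be a non-basic apex incident with $\delta$ via a negative edge in $y$, replace $D$ by $D\cup\{\delta\}$, $N$ by $N\cup\{j\}$, $\delta$ by any element of $[d]$ not in the new $D$, and $y$ by $\mathcal C(N,D\cup\{\delta\})$. *)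

(* Defs.v *)
From HB Require Import structures.
From mathcomp Require Import all_boot all_order all_algebra.
From mathcomp Require Import classical_sets reals.

Set Implicit Arguments.
Unset Strict Implicit.
Unset Printing Implicit Defensive.

Import Order.TTheory GRing.Theory Num.Theory.

Local Open Scope ring_scope.

(* The third sign [Bullet] marks the pairs that are not edges of the finity
   graph. *)
Inductive tsign := Pos | Neg | Bullet.

Definition tsign_eqb (s t : tsign) : bool :=
  match s, t with
  | Pos, Pos | Neg, Neg | Bullet, Bullet => true
  | _, _ => false
  end.

Lemma tsign_eqP : Equality.axiom tsign_eqb.
Proof. by case; case; constructor. Qed.

HB.instance Definition _ := hasDecEq.Build tsign tsign_eqP.

(* A subgraph of K_{d,n} is its edge set; the edge (i, j) joins the coordinate
   node i to the apex node j. *)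
Notation bgraph d n := {set 'I_d * 'I_n}.

Section Graphs.
Variables d n : nat.
Implicit Types G : bgraph d n.

(* [inl i] is a coordinate node, [inr j] an apex node. *)
Definition adj G : rel ('I_d + 'I_n)%type := fun u v =>
  match u, v with
  | inl i, inr j | inr j, inl i => (i, j) \in G
  | _, _ => false
  end.

(* Simple cyclic walks of length 2 traverse one edge back and forth, and there
   are none of length 1. *)
Definition is_forest G : Prop :=
  forall c : seq ('I_d + 'I_n)%type, ucycle (adj G) c -> (size c <= 2)%N.

Definition apex_degree G (j : 'I_n) : nat := #|[set i | (i, j) \in G]|.

Definition no_isolated_apex G : bool :=
  [forall j, [exists i, (i, j) \in G]].

Definition supported_on (I : {set 'I_d}) G : bool :=
  [forall e in G, e.1 \in I].

Definition is_spanning_tree_on (I : {set 'I_d}) G : Prop :=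
  let in_nodes (u : 'I_d + 'I_n) := if u is inl i then i \in I else true in
  [/\ supported_on I G,
      forall u v, in_nodes u -> in_nodes v -> connect (adj G) u v
    & is_forest G].

End Graphs.

Section Polytopes.
Variables (R : realType) (d n : nat).

Notation ambient := ('rV[R]_n * 'rV[R]_d)%type.

Definition vertex (e : 'I_d * 'I_n) : ambient :=
  (delta_mx 0 e.2, delta_mx 0 e.1).

Definition conv (G : bgraph d n) : set ambient := fun x =>
  exists w : 'I_d * 'I_n -> R,
    [/\ forall e, e \in G -> 0 <= w e,
        \sum_(e in G) w e = 1
      & x = \sum_(e in G) w e *: vertex e].

(* [P] itself and the empty set are faces (take [l = 0] and [c = 0] or
   [c = 1]). *)
Definition is_face (F P : set ambient) : Prop :=
  exists (l : {scalar ambient}) (c : R),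
    (forall x, P x -> l x <= c) /\ (forall x, F x <-> P x /\ l x = c).

End Polytopes.

Section SignedTropicalMatroids.
Variables d n : nat.
Implicit Types (T : {set bgraph d n}) (Sigma : 'M[tsign]_(n, d)).

Definition finity_graph T : bgraph d n := \bigcup_(G in T) G.

Definition is_STM (R : realType) T Sigma : Prop :=
  [/\ forall i j, Sigma j i = Bullet <-> (i, j) \notin finity_graph T,
      forall G, G \in T -> no_isolated_apex G,
      forall H (G : bgraph d n), H \in T -> G \subset H -> no_isolated_apex G ->
        is_face (@conv R d n G) (conv H) -> G \in T,
      forall x, @conv R d n (finity_graph T) x ->
        exists2 H, H \in T & conv H x
    & forall G H : bgraph d n, G \in T -> H \in T -> G != H ->
        let GH := (@conv R d n G `&` conv H)%classic in
        GH = classical_sets.set0 \/ is_face GH (conv G) /\ is_face GH (conv H)].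

Definition is_full T : Prop := finity_graph T = [set: 'I_d * 'I_n].

Definition is_generic T : Prop := forall G, G \in T -> is_forest G.

Definition is_trimmed Sigma : Prop :=
  forall j, (#|[set i | Sigma j i == Neg]| <= 1)%N.

(* The coordinate nodes outside [I] are kept, as isolated nodes. *)
Definition contraction T (I : {set 'I_d}) : {set bgraph d n} :=
  [set G in T | supported_on I G].

Definition positive Sigma (e : 'I_d * 'I_n) : bool := Sigma e.2 e.1 == Pos.

Definition negative Sigma (e : 'I_d * 'I_n) : bool := Sigma e.2 e.1 == Neg.

Definition only_negative Sigma (G : bgraph d n) (j : 'I_n) : bool :=
  [forall i, ((i, j) \in G) ==> negative Sigma (i, j)].

Definition infeasible Sigma (G : bgraph d n) : bool :=
  [exists j, only_negative Sigma G j].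

Definition feasible Sigma (G : bgraph d n) : bool := ~~ infeasible Sigma G.

Definition totally_infeasible Sigma (G : bgraph d n) : bool :=
  infeasible Sigma G &&
  [forall i, [exists j, ((i, j) \in G) && negative Sigma (i, j)]].

Definition has_shape Sigma (j : 'I_n) (i : 'I_d) : bool := Sigma j i == Neg.

Definition same_shape Sigma (p r : 'I_n) : bool :=
  [exists i, has_shape Sigma p i && has_shape Sigma r i].

Definition all_degree_two (N : {set 'I_n}) (y : bgraph d n) : bool :=
  [forall j in N, apex_degree y j == 2%N].

(* The unique covector of the contraction to [I] in which all nodes of [N] have
   degree 2. If there is no such covector or more than one, the value is the
   junk graph without edges, which is not a covector when [0 < n]. *)
Definition cramer T (N : {set 'I_n}) (I : {set 'I_d}) : bgraph d n :=
  odflt (finset.set0 : bgraph d n)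
    [pick y in contraction T I |
      all_degree_two N y &&
      [forall z in contraction T I, all_degree_two N z ==> (z == y)]].

Definition is_basic T Sigma (N : {set 'I_n}) (D : {set 'I_d}) (delta : 'I_d)
    (y : bgraph d n) : Prop :=
  [/\ y \in T, delta \notin D, #|N| = #|D| & is_spanning_tree_on (delta |: D) y] /\
  [/\ forall j, j \in N -> apex_degree y j = 2%N,
      forall j, j \in N -> (delta, j) \in y -> ~~ negative Sigma (delta, j),
      forall j, j \in N -> exists i : 'I_d, (i, j) \in y /\ positive Sigma (i, j),
      forall j, j \in N -> exists i : 'I_d, (i, j) \in y /\ negative Sigma (i, j)
    & forall e f, e \in y -> f \in y -> negative Sigma e -> negative Sigma f ->
        e.2 \in N -> f.2 \in N -> e != f -> e.1 != f.1 /\ e.2 != f.2].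

End SignedTropicalMatroids.

Inductive verdict := Feasible | Infeasible | TotallyInfeasible.

(* The variables of the procedure; [ncalls] counts the calls made so far to the
   subroutine FindExtremeCovector. *)
Record vars (d n : nat) := Vars {
  supp : {set 'I_d};
  basis : {set 'I_n};
  dir : 'I_d;
  cov : bgraph d n;
  ncalls : nat
}.

Inductive answer := AnsFeasible | AnsInfeasible.

(* Program points: [LoopHead] is before (a), [Extreme] the test of the while
   loop in the running call of FindExtremeCovector, [Pivot v r] the body of that
   loop once the apex [r] has been chosen, and [LoopTest] is before (b). *)
Inductive config (d n : nat) :=
  | Start
  | LoopHead of vars d n
  | Extreme of vars d n
  | Pivot of vars d n & 'I_n
  | LoopTest of vars d n
  | Done of answer & bgraph d n & nat.

Arguments Start {d n}.

Definition calls (d n : nat) (c : config d n) : nat :=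
  match c with
  | Start => 0%N
  | LoopHead v | Extreme v | Pivot v _ | LoopTest v => ncalls v
  | Done _ _ k => k
  end.

Definition is_done (d n : nat) (c : config d n) : bool :=
  if c is Done _ _ _ then true else false.

Section Procedure.
Variables (d n : nat) (T : {set bgraph d n}) (Sigma : 'M[tsign]_(n, d)).

Definition check_feasible (N : {set 'I_n}) (delta : 'I_d) (y : bgraph d n) :
    verdict :=
  if [exists j, (j \notin N) && only_negative Sigma y j] then
    if [exists j, ((delta, j) \in y) && negative Sigma (delta, j)]
    then TotallyInfeasible else Infeasible
  else Feasible.

(* CheckFeasible is defined on basic covectors only, so a run that calls it on
   anything else is stuck. *)
Definition checks (v : vars d n) (a : verdict) : Prop :=
  is_basic T Sigma (basis v) (supp v) (dir v) (cov v) /\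
  check_feasible (basis v) (dir v) (cov v) = a.

(* The variables after the assignment y := C(N, D + delta). *)
Definition set_vars (D : {set 'I_d}) (N : {set 'I_n}) (delta : 'I_d) (k : nat) :
    vars d n :=
  Vars D N delta (cramer T N (delta |: D)) k.

(* Every "choose" / "let ... be any" of the procedure is a nondeterministic
   step. *)
Inductive step : config d n -> config d n -> Prop :=
  | step_init delta :
      step Start
        (LoopHead (set_vars finset.set0 finset.set0 delta 0%N))
  | step_call v :
      checks v Infeasible ->
      step (LoopHead v)
        (Extreme (Vars (supp v) (basis v) (dir v) (cov v) (ncalls v).+1))
  | step_nocall v a :
      checks v a -> a <> Infeasible ->
      step (LoopHead v) (LoopTest v)
  | step_enter v i r :
      checks v Infeasible ->
      r \notin basis v -> i \in supp v -> (i, r) \in cov v ->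
      negative Sigma (i, r) ->
      step (Extreme v) (Pivot v r)
  | step_pivot v r p :
      p \in basis v -> same_shape Sigma p r ->
      step (Pivot v r)
        (Extreme (set_vars (supp v) (r |: (basis v :\ p)) (dir v) (ncalls v)))
  | step_return v a :
      checks v a -> a <> Infeasible ->
      step (Extreme v) (LoopTest v)
  | step_feasible v :
      checks v Feasible ->
      step (LoopTest v) (Done AnsFeasible (cov v) (ncalls v))
  | step_infeasible v a :
      checks v a -> a <> Feasible -> dir v |: supp v = [set: 'I_d] ->
      step (LoopTest v) (Done AnsInfeasible (cov v) (ncalls v))
  | step_extend v a j (delta : 'I_d) :
      checks v a -> a <> Feasible -> dir v |: supp v <> [set: 'I_d] ->
      j \notin basis v -> (dir v, j) \in cov v -> negative Sigma (dir v, j) ->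
      delta \notin dir v |: supp v ->
      step (LoopTest v)
        (LoopHead (set_vars (dir v |: supp v) (j |: basis v) delta (ncalls v))).

Inductive reachable : config d n -> Prop :=
  | reachable_start : reachable Start
  | reachable_step c c' : reachable c -> step c c' -> reachable c'.

(* No infinite run, and no run gets stuck before returning. *)
Definition terminates : Prop :=
  Acc (fun c' c => step c c') Start /\
  forall c, reachable c -> is_done c \/ exists c', step c c'.

End Procedure.

(* Main.v *)
Require Import Defs.
From HB Require Import structures.
From mathcomp Require Import classical_sets boolp reals.
From mathcomp Require Import all_boot all_order all_algebra zify.

(** The procedure walks through the Cramer covectors of a triangulation of a
    product of two simplices, and the whole argument rests on one exchange
    property of its cells. Direct the edges of a covector [G] from coordinate
    nodes to apices and those of a covector [H] back ([displacement]). An edge of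
    [G] that closes a directed cycle is an edge of [H]: the edges of [G] and those
    of [H] on the cycle have the same vertex sum, hence the two polytopes meet in
    a point which, on the side of [G], puts weight on that edge, and the common
    face through this point contains the corresponding vertex
    ([displacement_exchange]). So if an edge of [G] is missing in [H], the nodes
    reachable from its apex form a cut, and since [H] is a forest, a cut satisfies
    a strict inequality between its numbers of coordinate nodes and of apices of
    degree two ([cut_of_missing_edge]). Everything else is counting against this
    inequality.

    Cramer covectors are unique because a cut between two of them is impossible;
    they exist because the covector that contains a suitable point with heavy
    apices in [N] has the required degrees ([cramer_covector_exists]).

    A Cramer covector with distinguished direction [delta] is basic as soon as its
    negative edges match the basis with [D]. If any covector contains such a
    matching between [D] and a set [N] of apices, then the Cramer covector of [N]
    contains it, too ([matched_persists]). After the exchange of a basic apex, and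
    after the extension of the support, the new basis is matched in the old
    covector by construction, so all covectors met by the procedure are basic.

    The matching makes a basic covector an arborescence with root [delta]
    ([arborescence_ind]). In geometric terms, exchanging a basic apex weakly
    decreases all coordinates relative to the one of [delta], and a cycle of
    exchanges would leave all of them at rest, although each exchange changes the
    basis ([pivot_acyclic]). This makes the subroutine terminate; the main loop
    enlarges the support in each round, and it does not call the subroutine in
    the first one, where the support is a single node. *)

Set Implicit Arguments.
Unset Strict Implicit.
Unset Printing Implicit Defensive.

Import Order.TTheory GRing.Theory Num.Theory.

(** * Forests *)

(** Extend a simple path at its head for as long as possible: either the new
    vertex is fresh, or it closes a cycle, which is not a mere back-and-forth
    because the neighbour was chosen distinct from the second vertex. *)
Lemma cycle_of_min_degree (V : finType) (e : rel V) (S : {set V}) :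
    symmetric e -> irreflexive e -> S != set0 ->
    (forall u v, u \in S -> exists w, [/\ w \in S, e u w & w != v]) ->
  exists c, ucycle e c /\ (2 < size c)%N.
Proof.
move=> sym_e irr_e /set0Pn[x0 Sx0] deg2.
suff /(_ #|V|) [//|[x [p [_ _ Up sz_p]]]] : forall k,
    (exists c, ucycle e c /\ (2 < size c)%N) \/
    exists x p, [/\ x \in S, path e x p, uniq (x :: p) & size p = k].
  by have := max_card (mem (x :: p)); rewrite (card_uniqP Up) /= sz_p ltnn.
elim=> [|k [cyc|[x [p [Sx xp Up sz_p]]]]]; first by right; exists x0, [::].
  by left.
have [w [Sw xw wNv]] := deg2 x (head x p) Sx.
have wNx : w != x by apply: contraTneq xw => ->; rewrite irr_e.
have [wp|wNp] := boolP (w \in p); last first.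
  right; exists w, (x :: p); rewrite Sw /= sym_e xw xp; split=> //; last by rewrite sz_p.
  by rewrite inE negb_or wNx wNp; move: Up => /= ->.
left; case/splitPr: wp xp Up wNv {sz_p} => p1 p2 xp Up wNv.
exists (x :: rcons p1 w); split; last first.
  by case: p1 wNv {xp Up} => [|y p1] /=; rewrite ?eqxx // size_rcons.
apply/andP; split.
  move: xp; rewrite cat_path /= => /and3P[p1x wl _].
  by rewrite rcons_path last_rcons rcons_path p1x wl /= sym_e.
by move: Up; rewrite -cat_rcons -cat_cons cat_uniq => /andP[].
Qed.

Section Forests.
Variables d n : nat.
Implicit Types G : bgraph d n.

Lemma adj_sym G : symmetric (adj G).
Proof. by case=> [i|j] [i'|j']. Qed.

(** A vertex of degree at most one exists by [cycle_of_min_degree]; it is removed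
    together with its edge. *)
Lemma forest_edges_within G (S : {set 'I_d + 'I_n}) :
    is_forest G -> S != set0 ->
  (#|[set e in G | (inl e.1 \in S) && (inr e.2 \in S)]| < #|S|)%N.
Proof.
move=> forG; move: {2}#|S| (erefl #|S|) => k; elim: k S => [|k IH] S cS SN0.
  by move: SN0; rewrite -cards_eq0 cS.
have [u [v [Su uv]]] : exists u v, u \in S /\
    forall w, w \in S -> adj G u w -> w = v.
  apply: contrapT => noleaf.
  have [] := @cycle_of_min_degree _ (adj G) S (adj_sym G) _ SN0.
  - by case.
  - move=> u v Su; apply: contrapT => Nw; apply: noleaf; exists u, v; split=> // w Sw uw.
    by apply/eqP/negPn/negP => wNv; apply: Nw; exists w.
  - by move=> c [/forG]; rewrite leqNgt => /negP.
pose leaf : bgraph d n := match u, v with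
  | inl i, inr j | inr j, inl i => [set (i, j)] | _, _ => set0 end.
have leaf1 : (#|leaf| <= 1)%N.
  by rewrite /leaf; case: (u) (v) => ? [] ?; rewrite ?cards0 ?cards1.
set E := fun S : {set _} => [set e in G | (inl e.1 \in S) && (inr e.2 \in S)].
have sub : E S \subset E (S :\ u) :|: leaf.
  apply/subsetP=> -[i j]; rewrite /E !inE /= => /and3P[Gij Si Sj].
  rewrite Gij Si Sj !andbT /=.
  have [ui|_] := eqVneq (inl i) u.
    have Guj : adj G u (inr j) by rewrite -ui.
    by rewrite /leaf -ui -(uv _ Sj Guj) inE eqxx orbT.
  have [uj|//] := eqVneq (inr j) u.
  have Gui : adj G u (inl i) by rewrite -uj.
  by rewrite /leaf -uj -(uv _ Si Gui) inE eqxx.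
have cSu : #|S :\ u| = k by move: cS; rewrite (cardsD1 u) Su => -[].
have le_ES := leq_trans (subset_leq_card sub) (leq_card_setU _ _).
have [S0|SuN0] := eqVneq (S :\ u) set0; last first.
  by have := IH _ cSu SuN0; rewrite -/(E _) -/(E _); lia.
have -> : #|S| = 1%N by rewrite (cardsD1 u) Su S0 cards0.
rewrite ltnS leqn0 cards_eq0; apply/eqP/setP=> -[i j]; rewrite !inE /=.
have Su1 w : w \in S -> w = u.
  by move=> Sw; apply/eqP/negPn/negP=> wNu; have := in_set0 w; rewrite -S0 !inE wNu Sw.
by apply/and3P=> -[_ /Su1 iu /Su1]; rewrite -iu.
Qed.

Lemma forest_edges G (X : {set 'I_d}) (Y : {set 'I_n}) :
    is_forest G -> (0 < #|X| + #|Y|)%N ->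
  (#|[set e in G | (e.1 \in X) && (e.2 \in Y)]| < #|X| + #|Y|)%N.
Proof.
move=> forG XY0; pose S : {set 'I_d + 'I_n} := inl @: X :|: inr @: Y.
have inlS i : (inl i \in S) = (i \in X).
  rewrite inE mem_imset; last by move=> ? ? [].
  by case: imsetP => [[]//|_]; rewrite orbF.
have inrS j : (inr j \in S) = (j \in Y).
  rewrite inE orbC mem_imset; last by move=> ? ? [].
  by case: imsetP => [[]//|_]; rewrite orbF.
have cS : #|S| = (#|X| + #|Y|)%N.
  rewrite cardsU disjoint_setI0 ?cards0 ?subn0 ?card_imset //; try by move=> ? ? [].
  by apply/pred0P=> u /=; apply/andP=> -[/imsetP[? _ ->] /imsetP[]].
have SN0 : S != set0 by rewrite -card_gt0 cS.
rewrite -cS; apply: leq_ltn_trans (forest_edges_within forG SN0).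
apply/subset_leq_card/subsetP=> e.
by rewrite in_set [in X in _ -> X]in_set inlS inrS.
Qed.

Lemma edges_at_apices G (Y : {set 'I_n}) :
  #|[set e in G | e.2 \in Y]| = \sum_(j in Y) apex_degree G j.
Proof.
rewrite -sum1_card (partition_big snd (mem Y)) /= => [|e]; last first.
  by rewrite inE => /andP[].
apply: eq_bigr => j Yj; rewrite /apex_degree.
rewrite -(@card_imset _ _ (fun i => (i, j))); last by move=> ? ? [].
rewrite -sum1_card; apply: eq_bigl => -[i k]; rewrite !inE /=.
apply/andP/imsetP => [[/andP[Gik _] /eqP kj]|[i' Gi' [-> ->]]].
  by exists i; rewrite ?inE -?kj.
by rewrite inE in Gi'; rewrite Gi' Yj eqxx.
Qed.

Lemma edges_at_apices_ge G N (Y : {set 'I_n}) :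
    no_isolated_apex G -> all_degree_two N G ->
  (#|Y| + #|Y :&: N| <= #|[set e in G | e.2 \in Y]|)%N.
Proof.
move=> /forallP iso /forall_inP deg2; rewrite edges_at_apices.
have -> : (#|Y| + #|Y :&: N| = \sum_(j in Y) (1 + (j \in N)))%N.
  rewrite big_split /= sum1_card; congr (_ + _)%N.
  rewrite -sum1_card (eq_bigl (fun j => (j \in Y) && (j \in N))) => [|j].
    by rewrite big_mkcondr; apply: eq_bigr => j _; case: (j \in N).
  by rewrite inE.
apply: leq_sum => j _; case: (boolP (j \in N)) => [/deg2/eqP->//|_].
by rewrite card_gt0; have /existsP[i Gij] := iso j; apply/set0Pn; exists i; rewrite inE.
Qed.

End Forests.

(** * Compatibility of covectors *)

Section Compatibility.
Local Open Scope ring_scope.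
Variables (R : realType) (d n : nat).
Implicit Types G H : bgraph d n.

Notation ambient := ('rV[R]_n * 'rV[R]_d)%type.
Notation vertex := (@vertex R d n).

(** The linear functional with prescribed values on the vertices of a product of
    simplices. *)
Definition separable (f : 'I_d -> R) (g : 'I_n -> R) (x : ambient) : R :=
  \sum_i f i * x.2 0 i + \sum_j g j * x.1 0 j.

Fact separable_is_linear f g : scalar (separable f g).
Proof.
move=> c x y; rewrite /separable mulrDr !mulr_sumr addrACA -!big_split /=.
by congr (_ + _); apply: eq_bigr => i _; rewrite !mxE mulrDr mulrCA.
Qed.

HB.instance Definition _ f g :=
  GRing.isLinear.Build R ambient R _ (separable f g) (separable_is_linear f g).

Lemma separable_vertex f g e : separable f g (vertex e) = f e.1 + g e.2.
Proof.
rewrite /separable /vertex /=; congr (_ + _).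
  rewrite (bigD1 e.1) //= big1 ?mxE ?eqxx ?mulr1 ?addr0 // => i /negPf iNe.
  by rewrite !mxE iNe andbF mulr0.
rewrite (bigD1 e.2) //= big1 ?mxE ?eqxx ?mulr1 ?addr0 // => i /negPf iNe.
by rewrite !mxE iNe andbF mulr0.
Qed.

Lemma linear_combination (l : {scalar ambient}) (A : bgraph d n) (w : 'I_d * 'I_n -> R) :
  l (\sum_(e in A) w e *: vertex e) = \sum_(e in A) w e * l (vertex e).
Proof. by rewrite linear_sum; apply: eq_bigr => e _; rewrite linearZ. Qed.

Lemma separable_combination f g (A : bgraph d n) (w : 'I_d * 'I_n -> R) :
  separable f g (\sum_(e in A) w e *: vertex e) = \sum_(e in A) w e * (f e.1 + g e.2).
Proof.
by rewrite linear_combination; apply: eq_bigr => e _; rewrite -separable_vertex.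
Qed.

Lemma vertex_in_conv H e : conv H (vertex e) -> e \in H.
Proof.
case=> w [w_ge0 w1 ew]; apply: contraTT isT => eNH.
pose l : {scalar ambient} := separable (fun i => (i == e.1)%:R) (fun j => (j == e.2)%:R).
have lE f : l (vertex f) = (f.1 == e.1)%:R + (f.2 == e.2)%:R := separable_vertex _ _ f.
have : l (vertex e) <= 1.
  rewrite ew linear_combination -w1; apply: ler_sum => f Hf.
  rewrite -[leRHS]mulr1 ler_wpM2l ?w_ge0 // lE.
  have : f != e by apply: contraNneq eNH => <-.
  case: f {Hf} e {l lE ew eNH} => [i j] [i' j']; rewrite -pair_eqE /=.
  by do 2!case: eqP => _ //; rewrite ?addr0 ?add0r.
by rewrite lE !eqxx -natrD lern1.
Qed.

Lemma face_contains_vertex F G w e :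
    is_face F (@conv R d n G) -> (forall f, f \in G -> 0 <= w f) ->
    \sum_(f in G) w f = 1 -> F (\sum_(f in G) w f *: vertex f) ->
    e \in G -> 0 < w e -> F (vertex e).
Proof.
case=> l [c [l_le FE]] w_ge0 w1 /FE[_]; rewrite linear_combination => lc Ge we.
have vG f : f \in G -> conv G (vertex f).
  move=> Gf; exists (fun h => (h == f)%:R); split=> [h _||]; first exact: ler0n.
    by rewrite (bigD1 f) //= eqxx big1 ?addr0 // => h /andP[_ /negPf->].
  rewrite (bigD1 f) //= eqxx scale1r big1 ?addr0 // => h /andP[_ /negPf->].
  by rewrite scale0r.
apply/FE; split; first exact: vG.
have defect0 : \sum_(f in G) w f * (c - l (vertex f)) = 0.
  under eq_bigr do rewrite mulrBr.
  by rewrite big_split /= -mulr_suml w1 sumrN lc mul1r subrr.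
have /eqP := defect0; rewrite psumr_eq0 => [/allP/(_ e)|f Gf]; last first.
  by rewrite mulr_ge0 ?w_ge0 // subr_ge0; apply/l_le/vG.
by rewrite mem_index_enum Ge mulf_eq0 gt_eqF //= subr_eq0 => /(_ isT)/eqP.
Qed.

Definition meet_in_faces (T : {set bgraph d n}) : Prop :=
  forall G H : bgraph d n, G \in T -> H \in T -> G != H ->
  let GH := (@conv R d n G `&` conv H)%classic in
  GH = classical_sets.set0 \/ is_face GH (conv G) /\ is_face GH (conv H).

(** Rescaled to total weight one, both sides are the same point of the two
    polytopes; it lies on their common face, which then contains every vertex
    that carries weight. *)
Lemma common_combination T G H a b e :
    meet_in_faces T -> G \in T -> H \in T ->
    (forall f, 0 <= a f) -> (forall f, 0 <= b f) ->
    \sum_(f in G) a f *: vertex f = \sum_(f in H) b f *: vertex f ->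
    e \in G -> 0 < a e -> e \in H.
Proof.
move=> faces TG TH a_ge0 b_ge0 ab Ge ae.
have [<-//|GNH] := eqVneq G H.
pose s := \sum_(f in G) a f.
have s_gt0 : 0 < s.
  by rewrite /s (bigD1 e) //= ltr_wpDr // sumr_ge0.
have sE : s = \sum_(f in H) b f.
  have := congr1 (separable (fun=> 1) (fun=> 0)) ab.
  rewrite !separable_combination; under eq_bigr do rewrite addr0 mulr1.
  by rewrite -/s => ->; apply: eq_bigr => f _; rewrite addr0 mulr1.
pose x := \sum_(f in G) (a f / s) *: vertex f.
have scaled A (w : _ -> R) :
    \sum_(f in A) (w f / s) *: vertex f = s^-1 *: \sum_(f in A) w f *: vertex f.
  by rewrite scaler_sumr; apply: eq_bigr => f _; rewrite scalerA mulrC.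
have Gx : conv G x.
  exists (fun f => a f / s); split=> // [f _|]; first by rewrite divr_ge0 // ltW.
  by rewrite -mulr_suml divff // gt_eqF.
have Hx : conv H x.
  exists (fun f => b f / s); split=> // [f _||]; first by rewrite divr_ge0 // ltW.
    by rewrite -mulr_suml -sE divff // gt_eqF.
  by rewrite /x !scaled ab.
have [GH0|[faceG _]] := faces G H TG TH GNH.
  have : (conv G `&` conv H)%classic x by split.
  by rewrite GH0.
apply: vertex_in_conv.
have w_ge0 f : f \in G -> 0 <= a f / s by move=> _; rewrite divr_ge0 // ltW.
have w1 : \sum_(f in G) a f / s = 1 by rewrite -mulr_suml divff // gt_eqF.
have GHx : (conv G `&` conv H)%classic x by split.
have we : 0 < a e / s by rewrite divr_gt0.
by have [] := face_contains_vertex faceG w_ge0 w1 GHx Ge we.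
Qed.

(** Suppose that [G] and [H] are the covectors of two points x and y, and let an
    apex have as its value the maximum that its edges attain. Then the change of
    value from y to x does not increase along an arc. *)
Definition displacement G H : rel ('I_d + 'I_n) := fun u v =>
  match u, v with
  | inl i, inr j => (i, j) \in G
  | inr j, inl i => (i, j) \in H
  | _, _ => false
  end.

(** The potential whose differences along the edges are the vertices
    ([vertex_node_vector]), so that walks telescope. *)
Definition node_vector (u : 'I_d + 'I_n) : ambient :=
  match u with inl i => (0, - delta_mx 0 i) | inr j => (delta_mx 0 j, 0) end.

Lemma add_edge G (a : 'I_d * 'I_n -> R) e : e \in G ->
  \sum_(f in G) (a f + (f == e)%:R) *: vertex f =
  \sum_(f in G) a f *: vertex f + vertex e.
Proof.
move=> Ge; under eq_bigr do rewrite scalerDl.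
rewrite big_split /=; congr (_ + _); rewrite (bigD1 e) //= eqxx scale1r.
by rewrite big1 ?addr0 // => f /andP[_ /negPf->]; rewrite scale0r.
Qed.

Lemma vertex_node_vector i j :
  vertex (i, j) = node_vector (inr j) - node_vector (inl i).
Proof.
by apply/eqP; rewrite /vertex -pair_eqE /= subr0 sub0r opprK !eqxx.
Qed.

Lemma walk_combination G H u v :
    connect (displacement G H) u v ->
  exists a b, [/\ forall f, 0 <= a f, forall f, 0 <= b f &
    \sum_(f in G) a f *: vertex f - \sum_(f in H) b f *: vertex f =
    node_vector v - node_vector u].
Proof.
case/connectP=> p + ->; elim: p u => [|w p IH] u /=.
  move=> _; exists (fun=> 0), (fun=> 0); split=> //.
  by rewrite !big1 ?subrr // => f _; rewrite scale0r.
case/andP=> uw /IH[a [b [a_ge0 b_ge0 ab]]].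
case: u w uw ab => [i|j] [i'|j'] //= uw ab.
  exists (fun f => a f + (f == (i, j'))%:R), b; split=> // [f|]; first by rewrite addr_ge0.
  by rewrite add_edge // vertex_node_vector addrAC ab subrKA.
exists a, (fun f => b f + (f == (i', j))%:R); split=> // [f|]; first by rewrite addr_ge0.
by rewrite add_edge // vertex_node_vector opprD addrA ab opprB subrKA.
Qed.

(** An edge of [G] and a walk from its apex back to its coordinate node form a
    closed walk, along which the edges of [G] and those of [H] have the same
    vertex sum. *)
Lemma displacement_exchange T G H i j :
    meet_in_faces T -> G \in T -> H \in T ->
    (i, j) \in G -> connect (displacement G H) (inr j) (inl i) -> (i, j) \in H.
Proof.
move=> faces TG TH Gij ji.
have [a [b [a_ge0 b_ge0 ab]]] := walk_combination ji.
apply: (@common_combination T G H (fun f => a f + (f == (i, j))%:R) b) => //.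
- by move=> f; rewrite addr_ge0.
- apply/eqP; rewrite -subr_eq0 add_edge // addrAC ab vertex_node_vector.
  by rewrite subrKA subrr.
by rewrite eqxx ltr_wpDl.
Qed.

End Compatibility.
(** * Cramer covectors *)

Section Counting.
Variables d n : nat.
Implicit Types (G : bgraph d n) (I : {set 'I_d}) (N : {set 'I_n}).

Lemma supported_edges I G : supported_on I G ->
  forall i j, (i, j) \in G -> i \in I.
Proof. by move=> /forall_inP sup i j /sup. Qed.

(** A forest with a leaf edge for every apex outside [N] and two edges for every
    apex of [N] already has as many edges as a spanning tree can have, so that no
    degree can be larger. *)
Lemma degrees_of_full_forest I N G :
    is_forest G -> supported_on I G -> #|I| = #|N|.+1 ->
    (forall j, 1 + (j \in N) <= apex_degree G j)%N ->
  forall j, apex_degree G j = (1 + (j \in N))%N.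
Proof.
move=> forG supG cI deg_ge j.
have sumE : (\sum_j (1 + (j \in N)) = n + #|N|)%N.
  rewrite big_split /= sum1_card card_ord; congr (_ + _)%N.
  by rewrite -sum1_card [RHS]big_mkcond; apply: eq_bigr => k _; case: (k \in N).
have [ge_sum eq_sum] := leqif_sum (fun k (_ : true) => leqif_eq (deg_ge k)).
have := @forest_edges _ _ G I setT forG; rewrite cI addSn => /(_ isT).
have -> : [set e in G | (e.1 \in I) && (e.2 \in [set: 'I_n])] =
    [set e in G | e.2 \in [set: 'I_n]].
  apply/setP=> -[i k]; rewrite !inE andbT /=.
  by case: (boolP (_ \in G)) => //= /(supported_edges supG) ->.
rewrite edges_at_apices cardsT card_ord ltnS => le_sum.
have sumT : (\sum_(k in [set: 'I_n]) apex_degree G k = \sum_k apex_degree G k)%N.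
  by apply: eq_bigl => k; rewrite inE.
move: eq_sum; rewrite eqn_leq ge_sum sumE addnC -sumT le_sum.
by move=> /esym/forall_inP/(_ j isT)/eqP.
Qed.

End Counting.

Section PointLocation.
Local Open Scope ring_scope.
Variables (R : realType) (d n : nat) (T : {set bgraph d n}) (Sigma : 'M[tsign]_(n, d)).
Hypotheses (stmT : is_STM R T Sigma) (fullT : is_full T).

Lemma covector_with_marginals (nu : 'I_d -> R) (mu : 'I_n -> R) :
    (forall i, 0 <= nu i) -> (forall j, 0 <= mu j) ->
    \sum_i nu i = 1 -> \sum_j mu j = 1 ->
  exists H w, [/\ H \in T, forall e, e \in H -> 0 <= w e,
    forall i, \sum_(e in H) w e * (e.1 == i)%:R = nu i
    & forall j, \sum_(e in H) w e * (e.2 == j)%:R = mu j].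
Proof.
move=> nu_ge0 mu_ge0 nu1 mu1; have [_ _ _ cover _] := stmT.
pose w0 (e : 'I_d * 'I_n) := nu e.1 * mu e.2.
have split_sum (F : 'I_d * 'I_n -> R) :
    \sum_(e in [set: 'I_d * 'I_n]) F e = \sum_i \sum_j F (i, j).
  by rewrite pair_bigA /=; apply: eq_big => [e|[i j]] //; rewrite inE.
pose x := \sum_(e in [set: 'I_d * 'I_n]) w0 e *: vertex R e.
have /cover[H TH [w [w_ge0 w1 xw]]] : conv (finity_graph T) x.
  rewrite fullT; exists w0; split=> // [e _|]; first by rewrite mulr_ge0.
  rewrite split_sum -[RHS]nu1; apply: eq_bigr => i _.
  by rewrite /w0 /= -mulr_sumr mu1 mulr1.
exists H, w; split=> // [i|j].
  have := congr1 (separable (fun k => (k == i)%:R) (fun=> 0)) xw.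
  rewrite !separable_combination => sepE.
  transitivity (\sum_(e in H) w e * ((e.1 == i)%:R + 0)).
    by apply: eq_bigr => e _; rewrite addr0.
  rewrite -sepE split_sum (bigD1 i) //=.
  rewrite [X in _ + X]big1 ?addr0 => [|k /negPf kNi]; last first.
    by rewrite big1 // => j _; rewrite /= kNi ?addr0 mulr0.
  under eq_bigr do rewrite /= eqxx ?addr0 mulr1.
  by rewrite /w0 /= -mulr_sumr mu1 mulr1.
have := congr1 (separable (fun=> 0) (fun k => (k == j)%:R)) xw.
rewrite !separable_combination => sepE.
transitivity (\sum_(e in H) w e * (0 + (e.2 == j)%:R)).
  by apply: eq_bigr => e _; rewrite add0r.
rewrite -sepE split_sum exchange_big (bigD1 j) //=.
rewrite [X in _ + X]big1 ?addr0 => [|k /negPf kNj]; last first.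
  by rewrite big1 // => i _; rewrite /= kNj ?addr0 mulr0.
under eq_bigr do rewrite /= eqxx ?add0r mulr1.
by rewrite /w0 /= -mulr_suml nu1 mul1r.
Qed.

(** The edges at [I] span the face on which the coordinates outside [I] vanish. *)
Lemma restrict_covector H (I : {set 'I_d}) :
    H \in T -> no_isolated_apex [set e in H | e.1 \in I] ->
  [set e in H | e.1 \in I] \in T.
Proof.
move=> TH iso; have [_ _ down _ _] := stmT.
apply: (down H _ TH _ iso); first by apply/subsetP=> e; rewrite inE => /andP[].
pose l : {scalar ('rV[R]_n * 'rV[R]_d)%type} :=
  separable (fun i => (i \in I)%:R) (fun=> 0).
have lE w : l (\sum_(e in H) w e *: vertex R e) = \sum_(e in H) w e * (e.1 \in I)%:R.
  apply: etrans (separable_combination _ _ _ _) _.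
  by apply: eq_bigr => e _; rewrite addr0.
exists l, 1; split=> [x [w [w_ge0 w1 ->]]|x].
  rewrite lE -[leRHS]w1 ler_sum // => e He.
  by rewrite -[leRHS]mulr1 ler_wpM2l ?w_ge0 // lern1 leq_b1.
have restrict (V : lmodType R) (F : 'I_d * 'I_n -> V) :
    \sum_(e in [set e in H | e.1 \in I]) F e = \sum_(e in H) (e.1 \in I)%:R *: F e.
  rewrite (eq_bigl (fun e => (e \in H) && (e.1 \in I))) => [|e]; last by rewrite inE.
  rewrite big_mkcondr; apply: eq_bigr => e _.
  by case: (e.1 \in I); rewrite ?scale1r ?scale0r.
split=> [[w [w_ge0 w1 ->]]|[[w [w_ge0 w1 ->]]]].
  have xE : \sum_(e in [set e in H | e.1 \in I]) w e *: vertex R e =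
      \sum_(e in H) (w e * (e.1 \in I)%:R) *: vertex R e.
    by rewrite restrict; apply: eq_bigr => e _; rewrite scalerA mulrC.
  have wE : \sum_(e in H) w e * (e.1 \in I)%:R = 1.
    by rewrite -[RHS]w1 (restrict R^o); apply: eq_bigr => e _; rewrite mulrC.
  split; last first.
    rewrite xE lE -[RHS]wE; apply: eq_bigr => e _.
    by case: (e.1 \in I); rewrite ?mulr1 ?mulr0.
  rewrite xE; exists (fun e => w e * (e.1 \in I)%:R); split=> // e He.
  by case: (boolP (e.1 \in I)) => Ie; rewrite ?mulr0 // mulr1 w_ge0 // inE He.
rewrite lE => lw.
have w0 e : e \in H -> e.1 \notin I -> w e = 0.
  move=> He eNI; have /eqP : \sum_(f in H) w f * (f.1 \notin I)%:R = 0.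
    transitivity (\sum_(f in H) w f - \sum_(f in H) w f * (f.1 \in I)%:R); last first.
      by rewrite w1 lw subrr.
    rewrite -sumrB; apply: eq_bigr => f _.
    by case: (f.1 \in I); rewrite /= ?mulr0 ?mulr1 ?subrr ?subr0.
  rewrite psumr_eq0 => [/allP/(_ e)|f Hf]; last by rewrite mulr_ge0 ?w_ge0 ?ler0n.
  by rewrite mem_index_enum He eNI mulr1 => /(_ isT)/eqP.
exists w; split=> [e||]; first by rewrite inE => /andP[/w_ge0].
  rewrite (restrict R^o) -[RHS]w1; apply: eq_bigr => e He.
  by case: (boolP (e.1 \in I)) => Ie; rewrite ?scale1r // scale0r w0.
rewrite restrict; apply: eq_bigr => e He.
by case: (boolP (e.1 \in I)) => Ie; rewrite ?scale1r // scale0r w0 // scale0r.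
Qed.

(** Locate the point whose coordinates in [I] have weight 1 each, while the apices
    in [N] have weight 1 + 1/n and the others 1/n (up to scaling): an apex of [N]
    is too heavy for a single coordinate node, so it has two edges with nonzero
    weight in the covector that contains the point. *)
Lemma cramer_covector_exists (N : {set 'I_n}) (I : {set 'I_d}) :
    is_generic T -> (0 < n)%N -> #|I| = #|N|.+1 ->
  exists2 G, G \in contraction T I & all_degree_two N G.
Proof.
move=> genT n_gt0 cI; set c : R := #|I|%:R.
have c_gt0 : 0 < c by rewrite /c cI ltr0Sn.
have n_gt0R : 0 < n%:R :> R by rewrite ltr0n.
pose nu (i : 'I_d) : R := (i \in I)%:R / c.
pose mu (j : 'I_n) : R := ((j \in N)%:R + n%:R^-1) / c.
have nat_sum m (A : {set 'I_m}) : \sum_i (i \in A)%:R = #|A|%:R :> R.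
  by rewrite -sum1_card natr_sum [RHS]big_mkcond; apply: eq_bigr => i _; case: (i \in A).
have nu_ge0 i : 0 <= nu i by rewrite divr_ge0 ?ler0n // ltW.
have mu_gt0 j : 0 < mu j by rewrite divr_gt0 // ltr_wpDl ?ler0n // invr_gt0.
have nu1 : \sum_i nu i = 1 by rewrite -mulr_suml nat_sum divff // gt_eqF.
have mu1 : \sum_j mu j = 1.
  rewrite -mulr_suml big_split /= nat_sum sumr_const card_ord.
  rewrite -[n%:R^-1 *+ n]mulr_natl divff ?gt_eqF //.
  by rewrite /c cI -natr1 divff // natr1 pnatr_eq0.
have [H [w [TH w_ge0 w_nu w_mu]]] :=
  covector_with_marginals nu_ge0 (fun j => ltW (mu_gt0 j)) nu1 mu1.
pose G := [set e in H | e.1 \in I].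
have w_le e : e \in H -> w e <= nu e.1.
  move=> He; rewrite -w_nu (bigD1 e) //= eqxx mulr1 lerDl sumr_ge0 // => f /andP[Hf _].
  by rewrite mulr_ge0 ?w_ge0 ?ler0n.
have w_out e : e \in H -> e.1 \notin I -> w e = 0.
  move=> He eNI; apply/le_anti; rewrite w_ge0 // andbT.
  by have := w_le e He; rewrite /nu (negPf eNI) mul0r.
have mu_G j : mu j = \sum_(i in [set i | (i, j) \in G]) w (i, j).
  rewrite -w_mu (bigID (fun e => (e.1 \in I) && (e.2 == j))) /= [X in _ + X]big1 ?addr0.
    rewrite (reindex_onto (fun i => (i, j)) fst) /=.
      by apply: eq_big => [i|i _]; rewrite ?inE ?eqxx ?andbT ?mulr1 //.
    by case=> i k /and3P[_ _ /eqP/= ->].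
  move=> [i k] /= /andP[Hik]; rewrite negb_and => /orP[|/negPf->]; last by rewrite mulr0.
  by move=> iNI; rewrite w_out ?mul0r.
have G_iso : no_isolated_apex G.
  apply/forallP=> j; apply: contraT; rewrite negb_exists => /forallP noG.
  by have := mu_gt0 j; rewrite mu_G big1 ?ltxx // => i; rewrite inE (negPf (noG i)).
have TG := restrict_covector TH G_iso.
have supG : supported_on I G by apply/forall_inP=> e; rewrite inE => /andP[].
have deg_ge j : (1 + (j \in N) <= apex_degree G j)%N.
  case: (boolP (j \in N)) => [Nj|_]; last first.
    have /existsP[i Gij] := forallP G_iso j.
    by rewrite card_gt0; apply/set0Pn; exists i; rewrite inE.
  rewrite ltnNge; apply/negP=> /card_le1P deg1.
  have /existsP[i Gij] := forallP G_iso j.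
  have : mu j <= nu i.
    rewrite mu_G (big_pred1 i) => [|k].
      by apply: w_le; move: Gij; rewrite inE => /andP[].
    have iA : i \in [set i | (i, j) \in G] by rewrite inE.
    by rewrite (deg1 _ iA) !inE.
  rewrite /mu /nu Nj ler_pM2r ?invr_gt0 // leNgt => /negP[].
  by rewrite ltr_pwDr ?invr_gt0 // lern1 leq_b1.
exists G; first by rewrite inE TG.
apply/forall_inP=> j Nj.
by rewrite (degrees_of_full_forest (genT _ TG) supG cI deg_ge) Nj.
Qed.

End PointLocation.

(** The combinatorial shadow of a full generic matroid: the remaining arguments
    make no reference to polytopes. *)
Record forest_exchange (d n : nat) (T : {set bgraph d n}) : Prop := ForestExchange {
  fe_covers : forall G, G \in T -> no_isolated_apex G;
  fe_forests : is_generic T;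
  fe_exchange : forall (G H : bgraph d n) (i : 'I_d) (j : 'I_n),
    G \in T -> H \in T -> (i, j) \in G ->
    connect (displacement G H) (inr j) (inl i) -> (i, j) \in H;
  fe_cramer : forall (N : {set 'I_n}) (I : {set 'I_d}), #|I| = #|N|.+1 ->
    exists2 G, G \in contraction T I & all_degree_two N G
}.

Lemma full_generic_forest_exchange (R : realType) (d n : nat)
    (T : {set bgraph d n}) (Sigma : 'M[tsign]_(n, d)) :
    is_STM R T Sigma -> is_full T -> is_generic T -> 0 < n ->
  forest_exchange T.
Proof.
move=> stmT fullT genT n_gt0; have [_ covers _ _ faces] := stmT.
split=> // [G H i j|N I]; first exact: displacement_exchange faces.
exact: (@cramer_covector_exists R d n T Sigma stmT fullT N I genT n_gt0).
Qed.
Section CramerCovectors.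
Variables (d n : nat) (T : {set bgraph d n}).
Hypothesis sysT : forest_exchange T.
Let covers_apices := fe_covers sysT.
Let forests := fe_forests sysT.
Let exchange := fe_exchange sysT.
Implicit Types (G H : bgraph d n) (i : 'I_d) (j : 'I_n).
Implicit Types (I X : {set 'I_d}) (N Y : {set 'I_n}).

(** If an edge of [G] is missing in [H], the nodes that can be reached from its
    apex form a cut: no edge of [G] leaves [X] except towards [Y], and [H] has so
    many edges at [Y], all of them towards [X], that [X] has to be large. *)
Lemma cut_of_missing_edge G H I N i j :
    G \in T -> H \in contraction T I -> all_degree_two N H ->
    (i, j) \in G -> (i, j) \notin H ->
  exists X Y, [/\ X \subset I, i \notin X, j \in Y,
    forall k l, k \in X -> (k, l) \in G -> l \in Y & #|Y :&: N| < #|X|].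
Proof.
rewrite inE => TG /andP[TH supH] deg2 Gij NHij.
pose reach := connect (displacement G H) (inr j).
pose X : {set 'I_d} := [set k in I | reach (inl k)].
pose Y : {set 'I_n} := [set l | reach (inr l)].
have Yj : j \in Y by rewrite inE /reach connect0.
exists X, Y; split=> //.
- by apply/subsetP=> k; rewrite inE => /andP[].
- by rewrite inE; apply: contra NHij => /andP[_ ji]; exact: exchange TG TH Gij ji.
- move=> k l; rewrite !inE => /andP[_ jk] Gkl.
  by apply: connect_trans jk _; apply: connect1.
have := edges_at_apices_ge Y (covers_apices TH) deg2.
have Y0 : 0 < #|X| + #|Y|.
  by rewrite addn_gt0 [0 < #|Y|]card_gt0; apply/orP; right; apply/set0Pn; exists j.
have := forest_edges (forests TH) Y0.
have -> : [set e in H | (e.1 \in X) && (e.2 \in Y)] = [set e in H | e.2 \in Y].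
  apply/setP=> -[k l]; rewrite !inE /=; apply/andP/andP=> [[-> /andP[_ ->]]//|[Hkl jl]].
  rewrite Hkl jl andbT (supported_edges supH Hkl); split=> //.
  by apply: connect_trans jl _; apply: connect1.
lia.
Qed.

Lemma cramer_degrees G I N j :
    G \in contraction T I -> all_degree_two N G -> #|I| = #|N|.+1 ->
  apex_degree G j = 1 + (j \in N).
Proof.
rewrite inE => /andP[TG supG] /forall_inP deg2 cI.
apply: degrees_of_full_forest (forests TG) supG cI _ _ => k.
case: (boolP (k \in N)) => [/deg2/eqP->//|_]; rewrite card_gt0.
have /existsP[i Gik] := forallP (covers_apices TG) k.
by apply/set0Pn; exists i; rewrite inE.
Qed.

Lemma cramer_covector_unique G H I N :
    #|I| = #|N|.+1 -> G \in contraction T I -> all_degree_two N G ->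
    H \in contraction T I -> all_degree_two N H -> G = H.
Proof.
move=> cI.
wlog suff GH : G H / G \in contraction T I -> all_degree_two N G ->
    H \in contraction T I -> all_degree_two N H -> G \subset H.
  by move=> GI GN HI HN; apply/eqP; rewrite eqEsubset !GH.
move=> GI GN HI HN; apply/subsetP=> -[i j] Gij; apply: contraT => NHij.
move: (GI); rewrite inE => /andP[TG supG].
(* By the cut, the edges of [G] at apices outside [Y] lie in a forest that is too
   small for the degrees of these apices. *)
have [X [Y [XI iNX _ GX ltYX]]] := cut_of_missing_edge TG HI HN Gij NHij.
have IXi : i \in I :\: X by rewrite inE iNX (supported_edges supG Gij).
have IX0 : 0 < #|I :\: X| + #|~: Y|.
  by rewrite addn_gt0 card_gt0; apply/orP; left; apply/set0Pn; exists i.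
have := forest_edges (forests TG) IX0.
have -> : [set e in G | (e.1 \in I :\: X) && (e.2 \in ~: Y)] = [set e in G | e.2 \in ~: Y].
  apply/setP=> -[k l]; rewrite !inE /=; case: (boolP (_ \in G)) => //= Gkl.
  rewrite (supported_edges supG Gkl) andbT.
  case: (boolP (l \in Y)) => [|NYl]; first by rewrite andbF.
  by rewrite andbT; apply: contra NYl => /GX/(_ Gkl).
have := edges_at_apices_ge (~: Y) (covers_apices TG) GN.
have := cardsD I X; rewrite (setIidPr XI).
have := subset_leq_card XI; have := cardsID Y N.
rewrite setIC setDE [N :&: ~: Y]setIC; clear -cI ltYX; lia.
Qed.

(** The counting bound leaves no edge to spare: a covector that fell into two
    components would have one edge less in the two together. *)
Lemma cramer_spanning_tree G I N :
    #|I| = #|N|.+1 -> G \in contraction T I -> all_degree_two N G ->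
  is_spanning_tree_on I G.
Proof.
move=> cI; rewrite inE => /andP[TG supG] GN; split=> // [u v uI vI|]; last exact: forests.
apply: contraT => Nuv; pose C := [set w | connect (adj G) u w].
pose X : {set 'I_d} := [set i in I | inl i \in C].
pose Y : {set 'I_n} := [set j | inr j \in C].
have GC i j : (i, j) \in G -> (inl i \in C) = (inr j \in C).
  move=> Gij; rewrite !inE; apply/idP/idP=> /connect_trans; apply; exact: connect1.
have uC : u \in C by rewrite inE connect0.
have vNC : v \notin C by rewrite inE.
have XY0 : 0 < #|X| + #|Y|.
  rewrite addn_gt0 !card_gt0; apply/orP.
  case: (u) uI uC => [i|j] uI uC; [left|right]; apply/set0Pn.
    by exists i; rewrite inE uI.
  by exists j; rewrite inE.
have NXY0 : 0 < #|I :\: X| + #|~: Y|.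
  rewrite addn_gt0 !card_gt0; apply/orP.
  case: (v) vI vNC => [i|j] vI vNC; [left|right]; apply/set0Pn.
    by exists i; rewrite in_setD [i \in X]inE vI (negPf vNC).
  by exists j; rewrite in_setC [j \in Y]inE.
have := forest_edges (forests TG) XY0; have := forest_edges (forests TG) NXY0.
have -> : [set e in G | (e.1 \in X) && (e.2 \in Y)] = [set e in G | e.2 \in Y].
  apply/setP=> -[k l]; rewrite inE [in RHS]inE /=; case: (boolP (_ \in G)) => //= Gkl.
  by rewrite inE [l \in Y]inE (GC _ _ Gkl) (supported_edges supG Gkl) /= andbb.
have -> : [set e in G | (e.1 \in I :\: X) && (e.2 \in ~: Y)] = [set e in G | e.2 \in ~: Y].
  apply/setP=> -[k l]; rewrite inE [in RHS]inE /=; case: (boolP (_ \in G)) => //= Gkl.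
  rewrite in_setD [k \in X]inE in_setC [l \in Y]inE (GC _ _ Gkl) (supported_edges supG Gkl) /=.
  by rewrite andbT andbb.
have XI : X \subset I by apply/subsetP=> k; rewrite inE => /andP[].
have := edges_at_apices_ge (~: Y) (covers_apices TG) GN.
have := edges_at_apices_ge Y (covers_apices TG) GN.
have := cardsD I X; rewrite (setIidPr XI); have := subset_leq_card XI.
have := cardsID Y N; rewrite setIC setDE [N :&: ~: Y]setIC.
have := cardsC Y; rewrite card_ord; clear -cI; lia.
Qed.

Lemma cramerP N I : #|I| = #|N|.+1 ->
  cramer T N I \in contraction T I /\ all_degree_two N (cramer T N I).
Proof.
move=> cI; rewrite /cramer; case: pickP => [y /and3P[]//|none].
have [G GI GN] := fe_cramer sysT cI; have := none G; rewrite /= GI GN /=.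
move=> /negbT/forall_inPn[H HI]; rewrite negb_imply => /andP[HN /eqP[]].
exact: cramer_covector_unique HN GI GN.
Qed.

End CramerCovectors.
(** * Basic covectors *)

Section BasicCovectors.
Variables (d n : nat) (T : {set bgraph d n}) (Sigma : 'M[tsign]_(n, d)).
Hypothesis sysT : forest_exchange T.
Let covers_apices := fe_covers sysT.
Let forests := fe_forests sysT.
Hypothesis no_bullet : forall i j, Sigma j i != Bullet.
Hypothesis trimmedS : is_trimmed Sigma.
Implicit Types (G y z : bgraph d n) (i k m delta : 'I_d) (j p q r : 'I_n).
Implicit Types (D I X W : {set 'I_d}) (N M Q Y : {set 'I_n}).

Local Notation neg := (negative Sigma).

Lemma shape_unique i k j : neg (i, j) -> neg (k, j) -> i = k.
Proof.
move=> ij kj; have /card_le1P/(_ i) := trimmedS j.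
by rewrite inE => /(_ ij k); rewrite !inE => /esym; rewrite [Sigma j k == _]kj => /eqP.
Qed.

Lemma card_shapes D Q :
  (forall i, i \in D -> exists2 q, q \in Q & neg (i, q)) -> #|D| <= #|Q|.
Proof.
move=> DQ; pose f i := [pick q in Q | neg (i, q)].
have fP i : i \in D -> exists q, [/\ f i = Some q, q \in Q & neg (i, q)].
  move=> /DQ[q Qq iq]; rewrite /f; case: pickP => [r /andP[]|/(_ q)]; first by exists r.
  by rewrite Qq iq.
have f_inj : {in D &, injective f}.
  move=> i k /fP[q [-> _ iq]] /fP[r [-> _ kr]] [qr].
  by apply: shape_unique iq _; rewrite qr.
rewrite -(card_in_imset f_inj) -(card_imset Q (@Some_inj _)).
apply/subset_leq_card/subsetP=> _ /imsetP[i /fP[q [-> Qq _]] ->].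
exact: imset_f.
Qed.

(** In a basic covector the negative edges at the basis match the basis with
    [D]; this matching is all that has to be maintained by the procedure. *)
Definition matched N D y : bool :=
  [forall i in D, exists q in N, neg (i, q) && ((i, q) \in y)].

Lemma matchedP N D y : reflect
  (forall i, i \in D -> exists q, [/\ q \in N, neg (i, q) & (i, q) \in y])
  (matched N D y).
Proof.
apply: (iffP forall_inP) => My i /My.
  by case/exists_inP=> q Nq /andP[]; exists q.
by case=> q [Nq iq yq]; apply/exists_inP; exists q => //; apply/andP.
Qed.

Lemma matched_shape N D y q : #|N| = #|D| -> matched N D y -> q \in N ->
  exists i, [/\ i \in D, neg (i, q) & (i, q) \in y].
Proof.
move=> cN /matchedP My Nq.
pose N0 := [set q in N | [exists i in D, neg (i, q) && ((i, q) \in y)]].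
have N0N : N0 \subset N by apply/subsetP=> r; rewrite inE => /andP[].
have leN : #|N| <= #|N0|.
  rewrite cN; apply: card_shapes => i Di; have [r [Nr ir yr]] := My i Di.
  by exists r => //; rewrite inE Nr; apply/exists_inP; exists i; rewrite ?ir.
have /eqP N0E : N0 == N by rewrite eqEcard N0N.
move: Nq; rewrite -N0E inE => /andP[_ /exists_inP[i Di /andP[iq yq]]].
by exists i.
Qed.

Lemma matched_inj N D y i p q : #|N| = #|D| -> matched N D y ->
  p \in N -> q \in N -> neg (i, p) -> neg (i, q) -> p = q.
Proof.
move=> cN My Np Nq ip iq; apply/eqP/negPn/negP => pNq.
have : #|D| <= #|N :\ p|.
  apply: card_shapes => k /(matchedP _ _ _ My)[r [Nr kr _]].
  have [rp|rNp] := eqVneq r p; last by exists r; rewrite // !inE rNp.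
  exists q; first by rewrite !inE eq_sym pNq.
  by rewrite (shape_unique kr (_ : neg (i, r))) ?rp.
by have := cardsD1 p N; rewrite Np cN => -> /=; rewrite ltnn.
Qed.

Lemma matched_edge N D y i q : #|N| = #|D| -> matched N D y ->
  q \in N -> neg (i, q) -> (i, q) \in y.
Proof.
move=> cN My Nq iq; have [k [_ kq yq]] := matched_shape cN My Nq.
by rewrite (shape_unique iq kq).
Qed.

(** The engine of the procedure. Were a matching edge of [y] missing in [z], the
    resulting cut would have the matching partners of [X] and one more apex in
    [Y], too many by the inequality of the cut. That [z] is the Cramer covector
    of the new basis while [y] is any covector lets this cover both the exchange
    of a basic apex and the extension of the support. *)
Lemma matched_persists N D delta y z :
    y \in T -> z \in contraction T (delta |: D) -> all_degree_two N z ->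
    matched N D y -> matched N D z.
Proof.
move=> Ty zI zN /matchedP My; apply/matchedP=> i Di.
have [q [Nq iq yq]] := My i Di; exists q; split=> //; apply: contraT => Nzq.
have [X [Y [XI iNX Yq yX ltYX]]] :=
  cut_of_missing_edge sysT Ty zI zN yq Nzq.
(* [q] has shape [i], which is not in [X]: this is the one apex more. *)
have : #|i |: X :\ delta| <= #|Y :&: N|.
  apply: card_shapes => k; rewrite !inE => /orP[/eqP->|/andP[kNd Xk]].
    by exists q; rewrite // inE Yq.
  have Dk : k \in D by have := subsetP XI k Xk; rewrite !inE (negPf kNd).
  by have [r [Nr kr yr]] := My k Dk; exists r; rewrite // inE Nr (yX k).
rewrite cardsU1 !inE (negPf iNX) andbF add1n.
move: ltYX; rewrite (cardsD1 delta X); case: (delta \in X) => /=.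
  by move=> ltX leX; have := leq_ltn_trans leX ltX; rewrite add1n ltnn.
by move=> ltX leX; have := leq_ltn_trans leX ltX; rewrite ltnNge leqnSn.
Qed.

Definition cov_of D delta N : bgraph d n := cramer T N (delta |: D).

Lemma cov_ofP D delta N : delta \notin D -> #|N| = #|D| ->
  cov_of D delta N \in contraction T (delta |: D) /\ all_degree_two N (cov_of D delta N).
Proof.
move=> dND cN; apply: (cramerP sysT).
by rewrite cardsU1 dND cN.
Qed.

Lemma cov_of_degree D delta N j : delta \notin D -> #|N| = #|D| ->
  apex_degree (cov_of D delta N) j = 1 + (j \in N).
Proof.
move=> dND cN; have [yI yN] := cov_ofP dND cN.
by apply: (cramer_degrees sysT _ yI yN); rewrite cardsU1 dND cN.
Qed.

Lemma two_edges_in_basis D delta N i k j : delta \notin D -> #|N| = #|D| ->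
    (i, j) \in cov_of D delta N -> (k, j) \in cov_of D delta N -> i != k -> j \in N.
Proof.
move=> dND cN ij kj iNk; have := cov_of_degree j dND cN.
rewrite /apex_degree (cardsD1 i) inE ij (cardsD1 k) !inE eq_sym iNk kj.
by case: (j \in N) => //; lia.
Qed.

Lemma matched_is_basic D delta N : delta \notin D -> #|N| = #|D| ->
    matched N D (cov_of D delta N) ->
  is_basic T Sigma N D delta (cov_of D delta N).
Proof.
move=> dND cN My; set y := cov_of D delta N in My *.
have [yI yN] := cov_ofP dND cN; rewrite -/y in yI yN.
have cI : #|delta |: D| = #|N|.+1 by rewrite cardsU1 dND cN.
have deg2 j : j \in N -> apex_degree y j = 2 by move=> Nj; rewrite cov_of_degree ?Nj.
have shape_D j i : j \in N -> neg (i, j) -> i \in D.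
  by move=> /(matched_shape cN My)[k [Dk kj _]] ij; rewrite (shape_unique ij kj).
split; split=> //.
- by move: yI; rewrite inE => /andP[].
- exact: (cramer_spanning_tree sysT cI yI yN).
- by move=> j Nj _; apply: contra dND => /(shape_D _ _ Nj).
- move=> j Nj; have [i [_ ij yij]] := matched_shape cN My Nj.
  have := deg2 j Nj; rewrite /apex_degree (cardsD1 i) inE yij => -[/eqP/cards1P[k kE]].
  have : k \in [set k | (k, j) \in y] :\ i by rewrite kE inE.
  rewrite !inE => /andP[kNi ykj]; exists k; split=> //; rewrite /positive /=.
  have : Sigma j k != Neg by apply: contra kNi => kj; apply/eqP/(shape_unique kj ij).
  by have := no_bullet k j; case: (Sigma j k).
- by move=> j /(matched_shape cN My)[i [_ ij yij]]; exists i.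
move=> [i j] [k l] _ _ ij kl /= Nj Nl; rewrite -pair_eqE /= => ijNkl.
have [ik|iNk] := eqVneq i k.
  rewrite ik in ij ijNkl; move: ijNkl.
  by rewrite (matched_inj cN My Nj Nl ij kl) !eqxx.
split=> //; apply: contra iNk => /eqP jl; rewrite jl in ij.
exact/eqP/(shape_unique ij kl).
Qed.

(** The matching orients every basis apex from its shape to its other neighbour,
    and this makes the spanning tree an arborescence towards [delta]: a set of
    nodes of [D] that is closed under taking parents would span, together with
    its basis apices, too many edges for a forest. *)
Lemma arborescence_ind D delta N (P : 'I_d -> Prop) :
    delta \notin D -> #|N| = #|D| -> matched N D (cov_of D delta N) -> P delta ->
    (forall m k q, m \in D -> q \in N -> k != m -> neg (m, q) ->
      (m, q) \in cov_of D delta N -> (k, q) \in cov_of D delta N -> P k -> P m) ->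
  forall m, m \in delta |: D -> P m.
Proof.
move=> dND cN My Pdelta Pstep; set y := cov_of D delta N in My Pstep *.
have [yI yN] := cov_ofP dND cN; rewrite -/y in yI yN.
move: yI; rewrite inE => /andP[Ty supy].
pose W := [set m in D | ~~ `[< P m >]].
pose Q := [set q in N | [exists m in W, neg (m, q) && ((m, q) \in y)]].
have leWQ : #|W| <= #|Q|.
  apply: card_shapes => m Wm; have := Wm; rewrite inE => /andP[Dm _].
  have [q [Nq mq yq]] := matchedP _ _ _ My m Dm.
  by exists q => //; rewrite inE Nq; apply/exists_inP; exists m; rewrite ?mq.
have [W0|WN0] := eqVneq W set0.
  move=> m; rewrite !inE => /orP[/eqP-> //|Dm].
  by have := in_set0 m; rewrite -W0 inE Dm => /negbFE/asboolP.
have WQ0 : 0 < #|W| + #|Q| by rewrite addn_gt0 card_gt0 WN0.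
have := forest_edges (forests Ty) WQ0.
have -> : [set e in y | (e.1 \in W) && (e.2 \in Q)] = [set e in y | e.2 \in Q].
  apply/setP=> -[k q]; rewrite inE [in RHS]inE /=; case: (boolP (_ \in y)) => //= ykq.
  case: (boolP (q \in Q)); last by rewrite andbF.
  rewrite andbT inE => /andP[Nq /exists_inP[m Wm /andP[mq ymq]]].
  have [-> //|kNm] := eqVneq k m; apply: contraT => NWk.
  have := Wm; rewrite inE => /andP[Dm /asboolP[]].
  apply: (Pstep m k q) => //; have := supported_edges supy ykq.
  move: NWk; rewrite !inE negb_and negbK => NWk /orP[/eqP-> //|Dk].
  by move: NWk; rewrite Dk => /asboolP.
have := edges_at_apices_ge Q (covers_apices Ty) yN.
have -> : Q :&: N = Q by apply/setIidPl/subsetP=> q; rewrite inE => /andP[].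
lia.
Qed.

(** Along the arborescence of the later covector, the displacement from the
    earlier covector can only fall down to zero at [delta]. *)
Lemma displacement_to_dir D delta N y m :
    delta \notin D -> #|N| = #|D| -> matched N D y -> matched N D (cov_of D delta N) ->
    m \in delta |: D ->
  connect (displacement y (cov_of D delta N)) (inl m) (inl delta).
Proof.
move=> dND cN My Mz Im.
apply: (arborescence_ind (P := fun m =>
  connect (displacement y (cov_of D delta N)) (inl m) (inl delta)) dND cN Mz) Im => // {m}.
move=> m k q Dm Nq _ mq _ zkq; apply: connect_trans.
apply: connect_trans (connect1 (_ : displacement _ _ _ (inr q))) (connect1 _) => //=.
exact: matched_edge cN My Nq mq.
Qed.

End BasicCovectors.
(** * Termination of the exchanges of basic apices *)

Section Pivots.
Variables (d n : nat) (T : {set bgraph d n}) (Sigma : 'M[tsign]_(n, d)).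
Hypothesis sysT : forest_exchange T.
Let covers_apices := fe_covers sysT.
Let exchange := fe_exchange sysT.
Hypothesis trimmedS : is_trimmed Sigma.

Variables (D : {set 'I_d}) (delta : 'I_d).
Hypothesis dND : delta \notin D.
Implicit Types (N M : {set 'I_n}) (i k m : 'I_d) (j p q r : 'I_n).

Local Notation neg := (negative Sigma).
Local Notation cov := (cov_of T D delta).
Local Notation matched N := (matched Sigma N D).

Definition pivot : rel {set 'I_n} := fun N N' =>
  [exists p, exists r, [&& p \in N, r \notin N, same_shape Sigma p r,
    N' == r |: (N :\ p) & [exists i in D, ((i, r) \in cov N) && neg (i, r)]]].

Definition basic_basis N : bool := (#|N| == #|D|) && matched N (cov N).

Lemma pivot_spec N N' : basic_basis N -> pivot N N' ->
  [/\ basic_basis N', matched N' (cov N) & exists r i,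
      [/\ N' = r |: (N' :\ r), r \notin N, (i, r) \in cov N, neg (i, r)
        & N' :\ r \subset N]].
Proof.
move=> /andP[/eqP cN My].
case/existsP=> p /existsP[r /and5P[Np NNr /existsP[s /andP[ps rs]] /eqP->]].
case/exists_inP=> i Di /andP[yr ir].
have si : s = i := shape_unique trimmedS rs ir.
rewrite {s}si in ps rs.
have My' : matched (r |: (N :\ p)) (cov N).
  apply/matchedP=> k Dk; have [q [Nq kq yq]] := matchedP _ _ _ _ My k Dk.
  have [qp|qNp] := eqVneq q p; last by exists q; rewrite !inE qNp Nq orbT.
  by exists r; rewrite !inE eqxx (shape_unique trimmedS kq (_ : neg (i, q))) ?qp.
have cN' : #|r |: (N :\ p)| = #|D|.
  by rewrite cardsU1 !inE (negPf NNr) andbF -cN (cardsD1 p N) Np.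
have [yI yN] := cov_ofP sysT dND cN.
have [zI zN] := cov_ofP sysT dND cN'.
have Ty : cov N \in T by move: yI; rewrite inE => /andP[].
split=> //.
  rewrite /basic_basis cN' eqxx.
  exact: (matched_persists sysT trimmedS Ty zI zN My').
exists r, i; split=> //; first by rewrite setD1K // !inE eqxx.
by apply/subsetP=> q; rewrite !inE => /andP[/negPf-> /andP[]].
Qed.

Lemma monotone_on_cycle (V : finType) (e : rel V) (x : V) (P : V -> Prop) u v :
    (forall u v, connect e x u -> connect e v x -> e u v -> P u -> P v) ->
    connect e x u -> connect e v x -> connect e u v -> P u -> P v.
Proof.
move=> mono xu vx /connectP[p up vE]; elim: p u xu up vE => [|w p IH] u xu /=.
  by move=> _ ->.
case/andP=> uw wp vE Pu; apply: (IH w _ wp vE).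
  by rewrite (connect_trans xu) ?connect1.
apply: mono Pu => //; apply: connect_trans _ vx.
by apply/connectP; exists p.
Qed.

(** Along a pivot the coordinates fall weakly while that of [delta] is fixed, so
    on a cycle of pivots nothing can move. Without actual coordinates this is
    seen from [delta] outwards: the neighbours of a node at rest are constant
    along the cycle, hence a basis apex to which it is a parent cannot leave the
    basis, as it could never return, and so the child is at rest as well. *)
Lemma pivot_acyclic N N' : basic_basis N -> pivot N N' -> ~~ connect pivot N' N.
Proof.
move=> bN NN'; apply/negP => N'N.
pose C M := connect pivot N M && connect pivot M N.
have basicC M : connect pivot N M -> basic_basis M.
  case/connectP=> p + ->; elim: p N bN {NN' N'N C} => //= M' p IH N bN.
  by case/andP=> /(pivot_spec bN)[bM' _ _]; apply: IH.
have CN : C N by rewrite /C !connect0.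
have CN' : C N' by rewrite /C connect1.
have const (P : {set 'I_n} -> Prop) :
    (forall M M', C M -> C M' -> pivot M M' -> P M -> P M') ->
    forall M M', C M -> C M' -> P M -> P M'.
  move=> mono M M' /andP[NM MN] /andP[NM' M'N]; apply: monotone_on_cycle NM M'N _.
    move=> K K' NK K'N KK'; apply: mono; rewrite // /C ?NK ?K'N ?andbT /=.
      by apply: connect_trans K'N; apply: connect1.
    by apply: connect_trans NK _; apply: connect1.
  exact: connect_trans MN NM'.
have cC M : C M -> #|M| = #|D| by move=> /andP[/basicC/andP[/eqP]].
have MC M : C M -> matched M (cov M) by move=> /andP[/basicC/andP[]].
have covP M : C M -> cov M \in contraction T (delta |: D) /\ all_degree_two M (cov M).
  by move=> /cC; apply: cov_ofP.
have TC M : C M -> cov M \in T by move=> /covP[]; rewrite inE => /andP[].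
pose at_rest k := forall M M', C M -> C M' -> pivot M M' ->
  connect (displacement (cov M) (cov M')) (inl delta) (inl k).
have rest_nbrs k : at_rest k ->
    forall M M' j, C M -> C M' -> (k, j) \in cov M -> (k, j) \in cov M'.
  move=> rest_k M M' j CM CM'; move: M M' CM CM'.
  apply: (const (fun M => (k, j) \in cov M)) => M M' CM CM' MM' Mkj.
  apply: exchange (TC _ CM) (TC _ CM') Mkj _.
  apply: connect_trans (rest_k _ _ CM CM' MM').
  have /existsP[m M'mj] := forallP (covers_apices (TC _ CM')) j.
  apply: connect_trans (connect1 (_ : displacement _ _ _ (inl m))) _ => //.
  have [_ MM'y _] := pivot_spec (basicC _ (proj1 (andP CM))) MM'.
  apply: displacement_to_dir (cC _ CM') MM'y (MC _ CM') _ => //.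
  have := proj1 (covP _ CM'); rewrite inE => /andP[_ /supported_edges].
  by apply; exact: M'mj.
have all_rest : forall k, k \in delta |: D -> at_rest k.
  apply: (arborescence_ind sysT trimmedS dND (cC _ CN) (MC _ CN)).
    by move=> M M' _ _ _; apply: connect0.
  move=> m k q Dm Nq kNm mq ymq ykq rest_k.
  have kq M : C M -> (k, q) \in cov M by move=> CM; exact: rest_nbrs ykq.
  (* If [q] enters as [r], its edge to [m] is in the covector already, beside the
     one to [k]; but a non-basic apex is a leaf. *)
  have qM M : C M -> q \in M.
    move=> CM; apply: contraLR Nq; apply: (const (fun M => is_true (q \notin M))) CM CN.
    move=> K K' CK CK' KK' NKq; apply: contra NKq => K'q.
    have [_ _ [r [i [K'E NKr yir ir sub]]]] :=
      pivot_spec (basicC _ (proj1 (andP CK))) KK'.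
    have [qr|qNr] := eqVneq q r; last by apply: (subsetP sub); rewrite !inE qNr.
    rewrite -qr in yir ir; rewrite (shape_unique trimmedS ir mq) in yir.
    by apply: (two_edges_in_basis sysT dND (cC _ CK) yir (kq _ CK)); rewrite // eq_sym.
  move=> M M' CM CM' MM'; apply: connect_trans (rest_k _ _ CM CM' MM') _.
  apply: connect_trans (connect1 (_ : displacement _ _ _ (inr q))) (connect1 _) => /=.
    exact: kq.
  exact: matched_edge (cC _ CM') (MC _ CM') (qM _ CM') mq.
have sub M M' : C M -> C M' -> cov M \subset cov M'.
  move=> CM CM'; apply/subsetP=> -[k j] ykj.
  have := proj1 (covP _ CM); rewrite inE => /andP[_ /supported_edges/(_ _ _ ykj)].
  by move=> /all_rest/rest_nbrs rest; exact: rest CM CM' ykj.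
have yE : cov N = cov N' by apply/eqP; rewrite eqEsubset !sub.
have [_ _ [r [_ [N'E NNr _ _ _]]]] := pivot_spec bN NN'.
have deg M (CM : C M) := cov_of_degree sysT r dND (cC M CM).
have := deg N' CN'; rewrite -yE (deg N CN) (negPf NNr) N'E !inE eqxx.
by [].
Qed.

(** Strictly decreasing because a basis that has been left cannot be reached
    again. *)
Definition pivot_rank N : nat := #|[set M | connect pivot N M]|.

Lemma pivot_rank_decr N N' : basic_basis N -> pivot N N' ->
  pivot_rank N' < pivot_rank N.
Proof.
move=> bN NN'; apply/proper_card/properP; split.
  by apply/subsetP=> M; rewrite !inE; apply/connect_trans/connect1.
by exists N; rewrite inE ?connect0 // pivot_acyclic.
Qed.

End Pivots.
(** * The procedure *)

Section Correctness.
Variables (d n : nat) (T : {set bgraph d n}) (Sigma : 'M[tsign]_(n, d)).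
Hypothesis d_gt0 : 0 < d.
Hypothesis sysT : forest_exchange T.
Let covers_apices := fe_covers sysT.
Hypothesis no_bullet : forall i j, Sigma j i != Bullet.
Hypothesis trimmedS : is_trimmed Sigma.

Local Notation neg := (negative Sigma).

Definition consistent (v : vars d n) : Prop :=
  [/\ dir v \notin supp v, cov v = cov_of T (supp v) (dir v) (basis v)
    & basic_basis T Sigma (supp v) (dir v) (basis v)].

Definition verdict_of (v : vars d n) : verdict :=
  check_feasible Sigma (basis v) (dir v) (cov v).

(** Each round of the loop makes at most one call and adds one node to the
    support. The bound at the head of the loop is one less, since a round with an
    empty support makes no call: there, infeasible means totally infeasible. *)
Definition invariant (c : config d n) : Prop :=
  match c with
  | Start => True
  | LoopHead v => consistent v /\ ncalls v <= #|supp v|.-1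
  | Extreme v => consistent v /\ ncalls v <= #|supp v|
  | Pivot v r => [/\ consistent v, ncalls v <= #|supp v|, r \notin basis v
      & exists i, [/\ i \in supp v, (i, r) \in cov v & neg (i, r)]]
  | LoopTest v => [/\ consistent v, ncalls v <= #|supp v| & verdict_of v <> Infeasible]
  | Done AnsInfeasible y k => k <= d - 1 /\ [/\ y \in T, totally_infeasible Sigma y
      & exists N D delta, is_basic T Sigma N D delta y]
  | Done AnsFeasible y k => k <= d - 1 /\ exists I : {set 'I_d},
      [/\ I != set0, y \in contraction T I & feasible Sigma y]
  end.

Definition rank_of (v : vars d n) : nat :=
  pivot_rank T Sigma (supp v) (dir v) (basis v).

Definition rank_bound : nat := #|{set 'I_n}|.

(** Lexicographic: the size of the support, then the rank of the basis with two
    units for each exchange. A round weighs enough to pay for the highest rank. *)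
Definition run_measure (c : config d n) : nat :=
  let round v := (d - #|supp v|) * (rank_bound.*2 + 4) in
  match c with
  | Start => d.+1 * (rank_bound.*2 + 4)
  | LoopHead v => round v + (rank_bound.*2 + 3)
  | Extreme v => round v + ((rank_of v).*2 + 2)
  | Pivot v _ => round v + ((rank_of v).*2 + 1)
  | LoopTest v => round v
  | Done _ _ _ => 0
  end.

Lemma consistent_facts v : consistent v ->
  [/\ cov v \in contraction T (dir v |: supp v), #|basis v| = #|supp v|,
      matched Sigma (basis v) (supp v) (cov v),
      is_basic T Sigma (basis v) (supp v) (dir v) (cov v) & #|supp v| < d].
Proof.
case=> dND yE /andP[/eqP cN My]; rewrite yE; split=> //.
- by have [] := cov_ofP sysT dND cN.
- exact: (matched_is_basic sysT no_bullet trimmedS).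
by have := max_card (dir v |: supp v); rewrite cardsU1 dND card_ord.
Qed.

Lemma infeasible_pivot v : consistent v -> verdict_of v = Infeasible ->
  exists i r, [/\ i \in supp v, r \notin basis v, (i, r) \in cov v & neg (i, r)].
Proof.
move=> cv; have [] := consistent_facts cv; rewrite inE => /andP[Ty supy] _ _ _ _.
rewrite /verdict_of /check_feasible; case: ifP => // /existsP[r /andP[NNr /forallP only]].
case: ifP => // /negbT; rewrite negb_exists => /forallP/(_ r) Ndir _.
have /existsP[i yir] := forallP (covers_apices Ty) r.
have ir : neg (i, r) by have := only i; rewrite yir.
exists i, r; split=> //; have := supported_edges supy yir.
rewrite !inE => /orP[/eqP id|//].
by move: Ndir; rewrite -id yir ir.
Qed.

Lemma totally_infeasible_dir v : consistent v ->
    verdict_of v <> Feasible -> verdict_of v <> Infeasible ->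
  infeasible Sigma (cov v) /\
  exists j, [/\ j \notin basis v, (dir v, j) \in cov v & neg (dir v, j)].
Proof.
move=> cv; have [_ cN My _ _] := consistent_facts cv; have [dND _ _] := cv.
rewrite /verdict_of /check_feasible; case: ifP => // /existsP[r /andP[_ only]].
case: ifP => // /existsP[j /andP[yj dj]] _ _; split; first by apply/existsP; exists r.
exists j; split=> //; apply: contra dND => Nj.
have [i [Di ij _]] := matched_shape trimmedS cN My Nj.
by rewrite (shape_unique trimmedS dj ij).
Qed.

Lemma consistent_start delta k : consistent (set_vars T set0 set0 delta k).
Proof.
split=> //=; rewrite ?inE // /basic_basis !cards0 eqxx.
by apply/matchedP=> i; rewrite inE.
Qed.

Lemma pivot_of_choice v r p i :
    r \notin basis v -> i \in supp v -> (i, r) \in cov v -> neg (i, r) ->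
    p \in basis v -> same_shape Sigma p r -> consistent v ->
  pivot T Sigma (supp v) (dir v) (basis v) (r |: (basis v :\ p)).
Proof.
move=> NNr Di yir ir Np pr [_ yE _].
apply/existsP; exists p; apply/existsP; exists r; rewrite Np NNr pr eqxx /=.
by apply/exists_inP; exists i; rewrite // -yE yir.
Qed.

Lemma consistent_extend v j delta k : consistent v ->
    j \notin basis v -> (dir v, j) \in cov v -> neg (dir v, j) ->
    delta \notin dir v |: supp v ->
  consistent (set_vars T (dir v |: supp v) (j |: basis v) delta k).
Proof.
move=> cv NNj yj dj dN; have [dND _ _] := cv.
have [yI cN /matchedP My _ _] := consistent_facts cv.
have cN' : #|j |: basis v| = #|dir v |: supp v| by rewrite !cardsU1 NNj dND cN.
have [zI zN] := cov_ofP sysT dN cN'.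
have Ty : cov v \in T by move: yI; rewrite inE => /andP[].
split=> //; rewrite /basic_basis cN' eqxx.
apply: (matched_persists sysT trimmedS Ty zI zN).
apply/matchedP=> i; rewrite !inE => /orP[/eqP->|/My[q [Nq iq yq]]].
  by exists j; rewrite !inE eqxx.
by exists q; rewrite !inE Nq orbT.
Qed.

Lemma feasible_of_verdict v : consistent v -> verdict_of v = Feasible ->
  feasible Sigma (cov v).
Proof.
move=> cv; have [_ _ _ [_ [_ _ pos _ _]] _] := consistent_facts cv.
rewrite /verdict_of /check_feasible; case: ifP => [_|/negbT]; first by case: ifP.
rewrite negb_exists => /forallP Nonly _; apply/negP=> /existsP[j only].
have := Nonly j; rewrite only andbT negbK => /pos[i [yij]].
by have := forallP only i; rewrite yij /positive /negative /= => /eqP->.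
Qed.

Lemma totally_infeasible_of_full v : consistent v ->
    verdict_of v <> Feasible -> verdict_of v <> Infeasible ->
    dir v |: supp v = setT ->
  totally_infeasible Sigma (cov v).
Proof.
move=> cv NF NI full; have [inf [j [_ yj dj]]] := totally_infeasible_dir cv NF NI.
have [_ _ /matchedP My _ _] := consistent_facts cv.
apply/andP; split=> //; apply/forallP=> i; have := in_setT i.
rewrite -full !inE => /orP[/eqP->|/My[q [_ iq yq]]]; apply/existsP.
  by exists j; rewrite yj.
by exists q; rewrite yq.
Qed.

Lemma step_invariant c c' : invariant c -> step T Sigma c c' ->
  invariant c' /\ run_measure c' < run_measure c.
Proof.
have rank_le v : rank_of v <= rank_bound.
  by rewrite /rank_of /rank_bound -cardsT; apply/subset_leq_card/subsetT.
move=> ic st; case: st ic => {c c'}.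
- move=> delta _; split; first by split=> //; exact: consistent_start.
  by rewrite /= cards0 subn0 mulSn [X in X < _]addnC ltn_add2r; lia.
- move=> v [_ inf] [cv le_calls]; have [i [r [Di _ _ _]]] := infeasible_pivot cv inf.
  have D0 : 0 < #|supp v| by rewrite card_gt0; apply/set0Pn; exists i.
  split; first by split=> //=; rewrite -(prednK D0) ltnS.
  by rewrite /= ltn_add2l; have := rank_le v; rewrite /rank_of /=; lia.
- move=> v a [_ <-] NI [cv le_calls]; split; last by rewrite /= -addn1 leq_add2l; lia.
  by split=> //; apply: leq_trans le_calls (leq_pred _).
- move=> v i r _ NNr Di yir ir [cv le_calls]; split; last by rewrite /= ltn_add2l; lia.
  by split=> //; exists i.
- move=> v r p Np pr [cv le_calls NNr [i [Di yir ir]]].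
  have [dND _ bv] := cv.
  have piv := pivot_of_choice NNr Di yir ir Np pr cv.
  have [b' _ _] := pivot_spec sysT trimmedS dND bv piv.
  split; first by split.
  have := pivot_rank_decr sysT trimmedS dND bv piv.
  rewrite /= ltn_add2l /rank_of /=.
  move: (pivot_rank _ _ _ _ _) (pivot_rank _ _ _ _ (basis v)) => a b.
  by clear; lia.
- move=> v a [_ <-] NI [cv le_calls]; split; last by rewrite /= -addn1 leq_add2l; lia.
  by split.
- move=> v [_ feas] [cv le_calls _]; have [yI _ _ _ ltD] := consistent_facts cv.
  split; last by rewrite /= muln_gt0 subn_gt0 ltD addn_gt0 orbT.
  split; first by rewrite subn1; apply: leq_trans le_calls _; rewrite -ltnS prednK.
  exists (dir v |: supp v); split=> //; last exact: feasible_of_verdict.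
  by apply/set0Pn; exists (dir v); rewrite !inE eqxx.
- move=> v a [_ <-] NF full [cv le_calls NI]; have [yI _ _ By ltD] := consistent_facts cv.
  split; last by rewrite /= muln_gt0 subn_gt0 ltD addn_gt0 orbT.
  split; first by rewrite subn1; apply: leq_trans le_calls _; rewrite -ltnS prednK.
  split; first by move: yI; rewrite inE => /andP[].
    exact: totally_infeasible_of_full.
  by exists (basis v), (supp v), (dir v).
move=> v a j delta [_ <-] NF _ NNj yj dj dN [cv le_calls NI].
have [dND _ _] := cv; have [_ _ _ _ ltD] := consistent_facts cv.
split; first by split; [exact: consistent_extend | rewrite /= cardsU1 dND].
rewrite /= cardsU1 dND add1n -(subnSK ltD) mulSn [X in X < _]addnC ltn_add2r.
by clear; lia.
Qed.

Lemma reachable_invariant c : reachable T Sigma c -> invariant c.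
Proof. by elim=> // c1 c2 _ inv1 /(step_invariant inv1)[]. Qed.

Lemma step_progress c : invariant c ->
  is_done c \/ exists c', step T Sigma c c'.
Proof.
case: c => [|v|v|v r|v|a y k] inv; last by left.
- by right; exists (LoopHead (set_vars T set0 set0 (Ordinal d_gt0) 0)); constructor.
- right; have [cv _] := inv; have [_ _ _ By _] := consistent_facts cv.
  case E : (verdict_of v); last first.
  + by exists (LoopTest v); apply: (@step_nocall _ _ _ _ _ TotallyInfeasible).
  + by eexists; apply: step_call; split.
  by exists (LoopTest v); apply: (@step_nocall _ _ _ _ _ Feasible).
- right; have [cv _] := inv; have [_ _ _ By _] := consistent_facts cv.
  case E : (verdict_of v); last first.
  + by exists (LoopTest v); apply: (@step_return _ _ _ _ _ TotallyInfeasible).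
  + have [i [r [Di NNr yir ir]]] := infeasible_pivot cv E.
    by exists (Pivot v r); apply: (@step_enter _ _ _ _ _ i).
  by exists (LoopTest v); apply: (@step_return _ _ _ _ _ Feasible).
- right; have [cv _ _ [i [Di yir ir]]] := inv.
  have [_ _ /matchedP My _ _] := consistent_facts cv.
  have [p [Np ip _]] := My i Di; eexists; apply: (@step_pivot _ _ T Sigma v r p Np).
  by apply/existsP; exists i; apply/andP.
right; have [cv _ NI] := inv; have [_ _ _ By _] := consistent_facts cv.
have [F|NF] : verdict_of v = Feasible \/ verdict_of v <> Feasible.
  by case: (verdict_of v); [left|right|right].
  by exists (Done AnsFeasible (cov v) (ncalls v)); apply: step_feasible.
have [full|Nfull] := eqVneq (dir v |: supp v) setT.
  exists (Done AnsInfeasible (cov v) (ncalls v)).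
  exact: (@step_infeasible _ _ _ _ _ (verdict_of v)).
have [_ [j [NNj yj dj]]] := totally_infeasible_dir cv NF NI.
have /subsetPn[delta _ dN] : ~~ (setT \subset dir v |: supp v) by rewrite subTset.
eexists; apply: (@step_extend _ _ _ _ _ (verdict_of v) j delta) => //.
exact/eqP.
Qed.

Lemma procedure_terminates : terminates T Sigma.
Proof.
split=> [|c /reachable_invariant]; last exact: step_progress.
suff acc k c :
    run_measure c < k -> invariant c -> Acc (fun c' c => step T Sigma c c') c.
  exact: (acc (run_measure Start).+1).
elim: k c => [c|k IH c ltck ic]; first by rewrite ltn0.
constructor=> c' /(step_invariant ic)[ic' lt_c'].
by apply: IH ic'; apply: leq_trans lt_c' ltck.
Qed.

Lemma calls_bound c : invariant c -> calls c <= d - 1.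
Proof.
have supp_le v : consistent v -> #|supp v| <= d - 1.
  by move=> /consistent_facts[_ _ _ _ ltD]; rewrite subn1 -ltnS prednK.
case: c => [|v|v|v r|v|[] y k] //=.
- by case=> /supp_le leD /leq_trans->//; apply: leq_trans leD; apply: leq_pred.
- by case=> /supp_le leD /leq_trans->.
- by case=> /supp_le leD /leq_trans->.
- by case=> /supp_le leD /leq_trans->.
- by case.
by case.
Qed.

End Correctness.

Theorem theorem65 (R : realType) (d n : nat)
    (T : {set bgraph d n}) (Sigma : 'M[tsign]_(n, d))
    (d_gt0 : (0 < d)%N) (n_gt0 : (0 < n)%N)
    (stmT : is_STM R T Sigma) (fullT : is_full T) (genericT : is_generic T)
    (trimmedS : is_trimmed Sigma) :
  [/\ terminates T Sigma,
      forall y k, reachable T Sigma (Done AnsInfeasible y k) ->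
        [/\ y \in T, totally_infeasible Sigma y
          & exists N D delta, is_basic T Sigma N D delta y],
      forall y k, reachable T Sigma (Done AnsFeasible y k) ->
        exists I : {set 'I_d},
          [/\ I != finset.set0, y \in contraction T I & feasible Sigma y]
    & forall c, reachable T Sigma c -> (calls c <= d - 1)%N].
Proof.
have sysT := full_generic_forest_exchange stmT fullT genericT n_gt0.
have [bullets _ _ _ _] := stmT.
have no_bullet i j : Sigma j i != Bullet.
  by apply/eqP=> /bullets; rewrite fullT inE.
pose inv := @reachable_invariant d n T Sigma d_gt0 sysT no_bullet trimmedS.
split.
- exact: procedure_terminates.
- by move=> y k /inv[].
- by move=> y k /inv[].
by move=> c /inv; apply: calls_bound.
Qed.
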